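(* Let $s\ge 1$ and $\Delta\ge 1$ be integers. Let $G$ be a multipartite graph with a partition $\mathcal{P}=(V_1,V_2,\ldots,V_r)$ such that $|V_i|=3s^2\Delta$ for each $i\in[r]$. If $\Delta(G)\le\Delta$, then $G$ has a factor of independent transversal blow-ups of size $s$ with respect to $\mathcal{P}$.
   Context: All graphs are finite and simple; $\Delta(G)$ denotes the maximum degree of $G$. A multipartite graph $G$ with partition $\mathcal{P}=(V_1,\ldots,V_r)$ is a graph whose vertex set is the disjoint union of the blocks $V_1,\ldots,V_r$, each of which is an independent set of $G$. An independent transversal blow-up of size $s$ with respect to $\mathcal{P}$ is an independent set of $G$ containing exactly $s$ vertices from each block $V_i$. A factor of independent transversal blow-ups of size $s$ is a set of pairwise vertex-disjoint independent transversal blow-ups of size $s$ whose union is $V(G)$. *)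

(* Defs.v *)
From mathcomp Require Import all_boot.

Set Implicit Arguments.
Unset Strict Implicit.
Unset Printing Implicit Defensive.

(* A finite simple graph is a symmetric irreflexive relation on a finType. *)
Definition simple_graph (T : finType) (e : rel T) : Prop :=
  symmetric e /\ irreflexive e.

Definition degree (T : finType) (e : rel T) (v : T) : nat :=
  #|[set w | e v w]|.

Definition max_degree (T : finType) (e : rel T) : nat :=
  \max_(v : T) degree e v.

Definition independent (T : finType) (e : rel T) (A : {set T}) : Prop :=
  forall u v : T, u \in A -> v \in A -> ~~ e u v.

Definition multipartite (T : finType) (e : rel T) (r : nat)
    (V : 'I_r -> {set T}) : Prop :=
  [/\ forall i j : 'I_r, i != j -> [disjoint V i & V j],
      \bigcup_(i < r) V i = [set: T]
    & forall i : 'I_r, independent e (V i)].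

Definition transversal_blowup (T : finType) (e : rel T) (r : nat)
    (V : 'I_r -> {set T}) (s : nat) (A : {set T}) : Prop :=
  independent e A /\ forall i : 'I_r, #|A :&: V i| = s.

Definition blowup_factor (T : finType) (e : rel T) (r : nat)
    (V : 'I_r -> {set T}) (s : nat) (F : {set {set T}}) : Prop :=
  [/\ forall A : {set T}, A \in F -> transversal_blowup e V s A,
      trivIset F
    & cover F = [set: T]].

(* Main.v *)
Require Import Defs.
From mathcomp Require Import all_boot.
From mathcomp Require Import perm zify.

Set Implicit Arguments.
Unset Strict Implicit.
Unset Printing Implicit Defensive.

(** Split every block into [3 s Delta] groups of [s] vertices and contract the
    groups.  The contracted graph has maximum degree at most [s Delta], and blocks
    of size [3 s Delta], so the theorem reduces to Haxell's bound: blocks of size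
    [3 d] can be partitioned into independent transversals if the maximum degree
    is at most [d].  For this bound, the vertices, all isolated at first, recover
    their edges one at a time.  When
    [v], of colour [a], gets its edges back, the colour class [a] is replaced by an
    independent transversal [f] through [v], and in each block the vertex of [f]
    trades colours with the old vertex of colour [a].  At most [d] vertices of a
    block cannot be traded, so [f] is sought among [2 d] vertices of each block,
    except for the block of [v], reduced to [v]: Haxell's domination criterion
    applies, because [2 d (n - 1) + 1 > 2 d (n - 1)]. *)

(** * Haxell's domination criterion for independent transversals *)

Section IndependentTransversals.

Variables T I : finType.

Definition transversal (e : rel T) (p : T -> I) (U : {set T}) (S : {set I})
    (f : I -> T) : Prop :=
  (forall i, i \in S -> f i \in U /\ p (f i) = i) /\
  (forall i j, i \in S -> j \in S -> ~~ e (f i) (f j)).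

Definition totally_dominates (e : rel T) (Z A : {set T}) : Prop :=
  forall v, v \in A -> exists2 z, z \in Z & e z v.

Lemma transversal_update e p (U : {set T}) (S : {set I}) f b y :
  symmetric e -> irreflexive e -> y \in U -> p y = b ->
  transversal e p U (S :\ b) f ->
  (forall i, i \in S :\ b -> ~~ e y (f i)) ->
  transversal e p U S (fun i => if i == b then y else f i).
Proof.
move=> es ei yU py [fU fi] yf; split=> [i iS|i j iS jS].
  by case: eqP => [->//|/eqP ib]; apply: fU; rewrite !inE ib.
case: eqP => [_|/eqP ib]; case: eqP => [_|/eqP jb].
- by rewrite ei.
- by apply: yf; rewrite !inE jb.
- by rewrite es; apply: yf; rewrite !inE ib.
- by apply: fi; rewrite !inE ?ib ?jb.
Qed.

(* Requiring [a \in S1] is what makes the induction work: in the merged system the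
   dominated family contains the merged class, so that the two vertices spent on
   [x] and [y] are paid for by un-merging it. *)
Lemma extend_transversal_or_dominate e p (U : {set T}) (S : {set I}) a f :
  symmetric e -> irreflexive e -> a \in S -> transversal e p U (S :\ a) f ->
  (exists g, transversal e p U S g) \/
  (exists (Z : {set T}) (S1 : {set I}),
    [/\ S1 \subset S, a \in S1, #|Z| <= 2 * #|S1|.-1
      & totally_dominates e Z [set v in U | p v \in S1]]).
Proof.
(* The outer induction, on the number of classes, serves the merging of two classes; the inner one,
   on the number of adjacent pairs, serves the deletion of an edge. *)
have [n] := ubnP #|S|; elim: n => // n IHn in e p U S f *.
have [m] := ubnP #|[set u : T * T | e u.1 u.2]|.
elim: m => // m IHm in e f *; rewrite !ltnS => le_m le_n es ei aS ft.
have [[x xU px]|noa] : (exists2 x, x \in U & p x = a) \/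
    (forall x, x \in U -> p x != a).
- case: (pickP [pred x in U | p x == a]) => [x /andP[xU /eqP px]|no].
    by left; exists x.
  by right=> x xU; have := no x; rewrite /= xU /= => ->.
- have [/existsP[b /andP[bS exy]]|] := boolP [exists b in S :\ a, e x (f b)];
    last first.
    move/existsPn=> nx; left; exists (fun i => if i == a then x else f i).
    by apply: transversal_update => // i iS; have := nx i; rewrite iS.
  case/setD1P: (bS) => bna bS'; set y := f b in exy.
  have [yU py] : y \in U /\ p y = b by apply: ft.1.
  have nxy : x != y by apply: contraTneq exy => ->; rewrite ei.
  (* Deleting edges at the class [a] never destroys [f]; it is done until some
     transversal [g] conflicts only in the last deleted edge [x y]. *)
  pose e' u v := e u v && ((u, v) != (x, y)) && ((u, v) != (y, x)).
  have e's : symmetric e'.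
    move=> u v; rewrite /e' es -!andbA; congr andb.
    by rewrite !xpair_eqE andbC [(v == y) && _]andbC [(v == x) && _]andbC.
  have e'i : irreflexive e' by move=> u; rewrite /e' ei.
  have e'e u v : e' u v -> e u v by case/andP => /andP[].
  have lt_e' : #|[set u : T * T | e' u.1 u.2]| < m.
    apply: leq_trans le_m; apply: proper_card; apply/properP; split.
      by apply/subsetP=> u; rewrite !inE; apply: e'e.
    by exists (x, y); rewrite !inE //= /e' eqxx andbF.
  have ft' : transversal e' p U (S :\ a) f.
    split=> [|i j iS jS]; first exact: ft.1.
    by apply: contra (ft.2 _ _ iS jS); apply: e'e.
  have [[g gt]|[Z [S1 [s1 s2 s3 dom]]]] := IHm e' f lt_e' le_n e's e'i aS ft';
    last first.
    right; exists Z, S1; split=> // v /dom [z zZ /e'e]; by exists z.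
  have [/andP[/eqP gx /eqP gy]|nxy'] := boolP ((g a == x) && (g b == y));
    last first.
    left; exists g; split=> [|i j iS jS]; first exact: gt.1.
    apply: contra nxy' => eij; have := gt.2 _ _ iS jS.
    have [_ pi] := gt.1 _ iS; have [_ pj] := gt.1 _ jS.
    rewrite /e' eij /= -negb_or negbK => /orP[]; rewrite xpair_eqE.
      move=> /andP[/eqP gi /eqP gj].
      have <- : i = a by rewrite -pi gi.
      have <- : j = b by rewrite -pj gj.
      by rewrite gi gj !eqxx.
    move=> /andP[/eqP gi /eqP gj].
    have <- : i = b by rewrite -pi gi.
    have <- : j = a by rewrite -pj gj.
    by rewrite gi gj !eqxx.
  (* Delete the neighbours of [x] and [y], and merge the class of [y] into that
     of [x].  A transversal of the new system misses one of the two classes,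
     so it can be completed by [x] or [y]. *)
  pose p' v := if p v == b then a else p v.
  pose U' := [set v in U | ~~ e x v & ~~ e y v].
  have aSb : a \in S :\ b by rewrite !inE eq_sym bna.
  have ltSb : #|S :\ b| < n by rewrite [#|S|](cardsD1 b) bS' in le_n.
  (* As [g] takes the values [x] at [a] and [y] at [b], its other values avoid the neighbours of
     both, hence lie in [U']. *)
  have gt' : transversal e p' U' ((S :\ b) :\ a) g.
    split=> [i|i j]; rewrite !inE.
      case/and3P=> ia ib iS; have [giU pgi] := gt.1 _ iS.
      have xa := gt.2 _ _ aS iS; have xb := gt.2 _ _ bS' iS.
      have gix : g i != x by apply: contraNneq ia => gi; rewrite -pgi gi px.
      have giy : g i != y by apply: contraNneq ib => gi; rewrite -pgi gi py.
      rewrite /p' pgi (negPf ib) giU; split=> //.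
      move: xa xb; rewrite gx gy /e' !xpair_eqE !eqxx (negPf gix) (negPf giy) /=.
      by rewrite !andbF !andbT => -> ->.
    case/and3P=> ia ib iS /and3P[ja jb jS].
    have [_ pgi] := gt.1 _ iS; have := gt.2 _ _ iS jS.
    have gix : g i != x by apply: contraNneq ia => gi; rewrite -pgi gi px.
    have giy : g i != y by apply: contraNneq ib => gi; rewrite -pgi gi py.
    by rewrite /e' !xpair_eqE (negPf gix) (negPf giy) /= !andbT.
  have [[h [hU hi]]|[Z [S1 [s1 s2 s3 dom]]]] := IHn e p' U' _ _ ltSb es ei aSb gt'.
    left; have hU1 i : i \in S :\ b ->
        [/\ h i \in U, ~~ e x (h i) & ~~ e y (h i)].
      by case/hU; rewrite inE => /and3P[].
    have hp i : i \in (S :\ b) :\ a -> p (h i) = i.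
      move=> /setD1P[ia iS]; have [_] := hU _ iS; rewrite /p'; case: eqP => //.
      by move=> _ ai; rewrite ai eqxx in ia.
    have [_ pa] := hU _ aSb; have [ha hxa hya] := hU1 _ aSb.
    have [pb|pb] := eqVneq (p (h a)) b.
      (* The vertex chosen for the merged class comes from class [b]: it is reassigned to [b], and
         [x] fills [a]. *)
      pose h1 i := if i == b then h a else h i.
      have h1t : transversal e p U (S :\ a) h1.
        apply: transversal_update => //.
          rewrite setDDl setUC -setDDl; split=> [i iS|i j iS jS].
            by split; [case: (hU1 i) => //; case/setD1P: iS | exact: hp].
          by apply: hi; [case/setD1P: iS|case/setD1P: jS].
        move=> i iS; apply: hi => //; move: iS; rewrite !inE.
        by case/and3P=> -> _ ->.
      exists (fun i => if i == a then x else h1 i).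
      apply: transversal_update => // i iS; rewrite /h1; case: (eqVneq i b) => [//|ib].
      by case: (hU1 i) => //; move: iS; rewrite !inE ib => /andP[_ ->].
    have {}pa : p (h a) = a by move: pa; rewrite /p' (negPf pb).
    have ht : transversal e p U (S :\ b) h.
      split=> // i iS; have [-> //|ia] := eqVneq i a.
      by split; [case: (hU1 i iS) | apply: hp; rewrite in_setD1 ia].
    exists (fun i => if i == b then y else h i).
    by apply: transversal_update => // i /hU1[].
  right; exists (Z :|: [set x; y]), (b |: S1).
  have bS1 : b \notin S1.
    by apply/negP=> /(subsetP s1); rewrite !inE eqxx.
  split.
  - by rewrite subUset sub1set bS' (subset_trans s1) // subsetDl.
  - by rewrite !inE s2 orbT.
  - have [] := leq_card_setU Z [set x; y]; move=> + _.
    by rewrite (cardsU1 b) bS1 cards2 nxy; have := cardsD1 a S1; rewrite s2; lia.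
  (* A vertex adjacent to neither [x] nor [y] survives in [U'], and if its class is [b] it counts
     there as class [a], which belongs to [S1]. *)
  - move=> v; rewrite !inE => /andP[vU pv].
    have [exv|nxv] := boolP (e x v); first by exists x; rewrite ?inE ?eqxx ?orbT.
    have [eyv|nyv] := boolP (e y v); first by exists y; rewrite ?inE ?eqxx ?orbT.
    case: (dom v) => [|z zZ ezv]; last by exists z; rewrite ?inE ?zZ.
    rewrite !inE vU nxv nyv /= /p'; case: eqP pv => //=.
- right; exists set0, [set a]; split; rewrite ?sub1set ?inE ?cards0 //.
  by move=> v; rewrite !inE => /andP[/noa /negPf->].
Qed.

Lemma card_totally_dominated e (Z A : {set T}) d :
  (forall v, degree e v <= d) -> totally_dominates e Z A -> #|A| <= d * #|Z|.
Proof.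
move=> deg dom; have sA : A \subset \bigcup_(z in Z) [set w | e z w].
  by apply/subsetP=> v /dom[z zZ ezv]; apply/bigcupP; exists z; rewrite ?inE.
apply: leq_trans (subset_leq_card sA) _.
rewrite mulnC -sum_nat_const; elim/big_rec2: _ => [|z m B _ leBm].
  by rewrite cards0.
by apply: leq_trans (leq_card_setU _ _) _; apply: leq_add (deg z) leBm.
Qed.

(** Classes are added one at a time. A failure would yield a nonempty family [S1] dominated by at
    most [2 * #|S1|.-1] vertices of degree at most [d], too few for its size. The vertex [t0] is a
    default value, supplying a function when [S] is empty. *)
Lemma transversal_of_card e p (U : {set T}) d (t0 : T) :
  symmetric e -> irreflexive e -> (forall v, degree e v <= d) ->
  (forall S : {set I}, S != set0 ->
    2 * d * #|S|.-1 < #|[set v in U | p v \in S]|) ->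
  exists f, transversal e p U setT f.
Proof.
move=> es ei deg big; move: (setT : {set I}) => S.
have [n] := ubnP #|S|; elim: n => // n IHn in S * => le_n.
have [->|/set0Pn[a aS]] := eqVneq S set0.
  by exists (fun=> t0); split=> i; rewrite inE.
have [f ft] : exists f, transversal e p U (S :\ a) f.
  by apply: IHn; move: le_n; rewrite (cardsD1 a) aS.
case: (extend_transversal_or_dominate es ei aS ft) => // -[Z [S1 [_ aS1 cZ dom]]].
have S1n0 : S1 != set0 by apply/set0Pn; exists a.
have := big _ S1n0; rewrite ltnNge => /negP[].
apply: leq_trans (card_totally_dominated deg dom) _.
by rewrite [2 * d]mulnC -mulnA leq_mul2l cZ orbT.
Qed.

End IndependentTransversals.

(** * Strong colouring of blocks of size at least [3 d] *)

Section StrongColoring.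

Variables (I C : finType) (e : rel (I * C)) (d : nat).
Hypotheses (es : symmetric e) (ei : irreflexive e).
Hypotheses (deg : forall v, degree e v <= d) (d_gt0 : 0 < d).
Hypothesis leC : 3 * d <= #|C|.

(** [C] indexes both the positions in a block and the colours, so each colour occurs exactly once in
    each block. *)
Definition row_injective (c : I * C -> C) : Prop :=
  forall i, injective (fun j => c (i, j)).

(** The vertex [x0] of colour [a] in row [i] may take any colour absent from its neighbours. They
    rule out at most [d] colours, hence at most [d] positions of the row. *)
Lemma card_swappable c i a :
  row_injective c ->
  2 * d <= #|[set j | [forall x, forall y,
    [&& x.1 == i, c x == a & e x y] ==> (c y != c (i, j))]]|.
Proof.
move=> cinj; set G := finset _.
pose x0 := (i, invF (cinj i) a).
suff le_bad : #|~: G| <= d.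
  by have := cardsC G; have := leC; rewrite -(leq_add2r #|~: G|); lia.
rewrite -(card_imset _ (cinj i)); apply: leq_trans (deg x0).
apply: leq_trans (leq_imset_card c _); apply: subset_leq_card.
apply/subsetP=> k /imsetP[j + ->]; rewrite !inE => /forallPn[[i' j']].
case/forallPn=> y; rewrite negb_imply negbK.
case/andP=> /and3P[/eqP/= -> /eqP ca exy] /eqP <-; apply: imset_f; rewrite inE /x0.
suff -> : invF (cinj i) a = j' by [].
by rewrite -ca (invF_f (cinj i)).
Qed.

Lemma strong_coloring :
  exists2 c, row_injective c & forall x y, e x y -> c x != c y.
Proof.
suff [c cinj ce] : exists2 c, row_injective c &
    forall x y, x \in setT -> y \in setT -> e x y -> c x != c y.
  by exists c => // x y; apply: ce; rewrite inE.
(* [W] holds the vertices that have recovered their edges: an edge counts once both ends are in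
   [W]. *)
move: (setT : {set I * C}) => W.
have [n] := ubnP #|W|; elim: n => // n IHn in W * => le_n.
have [->|/set0Pn[v vW]] := eqVneq W set0.
  by exists snd => [i j k|x y]; rewrite ?inE.
have [c cinj ce] : exists2 c, row_injective c &
    forall x y, x \in W :\ v -> y \in W :\ v -> e x y -> c x != c y.
  by apply: IHn; move: le_n; rewrite (cardsD1 v) vW.
pose a := c v.
pose eW x y := [&& x \in W, y \in W & e x y].
pose U := [set w : I * C | if w.1 == v.1 then w == v else
  [forall x, forall y, [&& x.1 == w.1, c x == a & e x y] ==> (c y != c w)]].
have [f [fU fi]] : exists f, transversal eW fst U setT f.
  apply: (@transversal_of_card _ _ eW fst U d v).
  - by move=> x y; rewrite /eW es andbCA.
  - by move=> x; rewrite /eW ei !andbF.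
  - move=> x; apply: leq_trans (deg x); apply: subset_leq_card.
    by apply/subsetP=> y; rewrite !inE => /and3P[].
  move=> S /set0Pn[i0 i0S].
  have cardU i : (if i == v.1 then 1 else 2 * d) <=
      #|[set w in U | w.1 == i]|.
    have [->|iv] := eqVneq i v.1.
      rewrite card_gt0; apply/set0Pn; exists v.
      by rewrite !inE !eqxx.
    apply: leq_trans (card_swappable i a cinj) _.
    have pinj : injective (pair i : C -> I * C) by move=> ? ? [].
    rewrite -(card_imset _ pinj); apply: subset_leq_card.
    apply/subsetP=> _ /imsetP[j + ->].
    by rewrite !inE /= (negPf iv) eqxx andbT.
  have -> : #|[set w in U | w.1 \in S]| =
      \sum_(i in S) #|[set w in U | w.1 == i]|.
    rewrite -sum1dep_card (partition_big fst (mem S)) /=; last first.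
      by move=> w /andP[].
    apply: eq_bigr => i iS; rewrite -sum1dep_card; apply: eq_bigl => w.
    by case: eqP => [->|]; rewrite ?iS ?andbF ?andbT.
  apply: leq_trans (_ : \sum_(i in S) (if i == v.1 then 1 else 2 * d) <= _);
    last by apply: leq_sum.
  (* The sum is [1 + 2 * d * #|S|.-1] if [S] contains the block of [v], and [2 * d * #|S|]
     otherwise, where [d_gt0] makes the bound strict. *)
  have [vS|vS] := boolP (v.1 \in S).
    rewrite (bigD1 v.1) //= eqxx (eq_bigr (fun=> 2 * d)); last first.
      by move=> i /andP[_ /negPf->].
    rewrite (eq_bigl (mem (S :\ v.1))); last by move=> i; rewrite !inE andbC.
    by rewrite sum_nat_const (cardsD1 v.1 S) vS mulnC.
  rewrite (eq_bigr (fun=> 2 * d)).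
    rewrite sum_nat_const mulnC ltn_pmul2r ?muln_gt0 ?d_gt0 //.
    by rewrite (cardsD1 i0) i0S.
  by move=> i iS; case: eqP => // iv; rewrite -iv iS in vS.
have fp i : (f i).1 = i by case: (fU i (in_setT _)).
have fv : f v.1 = v.
  by have [+ _] := fU v.1 (in_setT _); rewrite inE fp eqxx => /eqP.
(* Permuting the colours within a row keeps it injective. The row of [v] is unchanged, because [f]
   picks [v] there. *)
exists (fun w => tperm a (c (f w.1)) (c w)) => [i j k /perm_inj/cinj //|].
move=> x y xW yW exy; apply/eqP=> cxy.
have cf z : c z = c (f z.1) -> z = f z.1.
  case: z => i j /=; case: (f i) (fp i) => _ k /= -> /cinj -> //.
have f_indep z t : z \in W -> t \in W -> e z t -> z = f z.1 -> t = f t.1 -> False.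
  move=> zW tW ezt zf tf; have := fi z.1 t.1 (in_setT _) (in_setT _).
  by rewrite -zf -tf /eW zW tW ezt.
have ne_v z : z \in W -> c z <> a -> z \in W :\ v.
  by move=> zW cza; rewrite !inE zW andbT; apply/eqP=> zv; rewrite zv in cza.
(* No conflict at an old vertex [z] of colour [a]: a neighbour [t] that keeps its colour is excluded
   by the choice of [U]; the other cases contradict the independence of [f] or the old colouring. *)
have recoloured z t : z \in W -> t \in W -> e z t -> c z = a ->
    tperm a (c (f z.1)) (c z) = tperm a (c (f t.1)) (c t) -> False.
  move=> zW tW ezt cza; rewrite cza tpermL => czt.
  have [cta|/eqP cta] := eqVneq (c t) a.
    rewrite cta tpermL in czt.
    have [zv|zv] := eqVneq z v.
      apply: (f_indep z t) => //; first by rewrite zv fv.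
      by apply: cf; rewrite cta -czt zv fv.
    have [tv|tv] := eqVneq t v.
      apply: (f_indep z t) => //; last by rewrite tv fv.
      by apply: cf; rewrite cza czt tv fv.
    have := ce z t; rewrite !inE zv tv zW tW cza cta eqxx.
    by move=> /(_ isT isT ezt).
  move: czt; case: tpermP => // [ctf|_ _] czt.
    by apply: (f_indep z t) => //; apply: cf => //; rewrite cza czt.
  have [zv|zv] := eqVneq z.1 v.1; first by apply: cta; rewrite -czt zv fv.
  have [+ _] := fU z.1 (in_setT _); rewrite inE fp (negPf zv).
  move=> /forallP/(_ z)/forallP/(_ t).
  by rewrite eqxx cza eqxx ezt czt eqxx.
have [cxa|/eqP cxa] := eqVneq (c x) a; first exact: (recoloured x y).
have [cya|/eqP cya] := eqVneq (c y) a.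
  by apply: (recoloured y x) => //; rewrite es.
move: cxy; case: tpermP => [//|cxf|_ _]; case: tpermP => [//|cyf|_ _] cxy.
- by apply: (f_indep x y) => //; apply: cf.
- by apply: cya; rewrite -cxy.
- exact: cxa.
- by have := ce x y (ne_v _ xW cxa) (ne_v _ yW cya) exy; rewrite cxy eqxx.
Qed.

End StrongColoring.

(** * Contraction of groups of [s] vertices *)

Lemma fiber_bijection (T I Q : finType) (p : T -> I) :
  (forall i, #|[set v | p v == i]| = #|Q|) ->
  exists2 h : I * Q -> T, bijective h & forall x, p (h x) = x.1.
Proof.
move=> cardp.
pose rank (x : I * Q) := cast_ord (esym (cardp x.1)) (enum_rank x.2).
pose h x : T := enum_val (rank x).
have hp x : p (h x) = x.1.
  by have := enum_valP (rank x); rewrite inE => /eqP.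
exists h => //; apply: inj_card_bij.
  move=> [i q] [j q'] hh; have := hp (i, q); rewrite hh hp /= => ji.
  by move: hh; rewrite ji => /enum_val_inj/cast_ord_inj/enum_rank_inj/= ->.
rewrite card_prod -sum1_card (partition_big p predT) //= -sum_nat_const.
by apply: leq_sum => i _; rewrite -(cardp i) -sum1dep_card.
Qed.

Theorem theorem5p4 (s Delta : nat) (hs : 1 <= s) (hDelta : 1 <= Delta)
    (T : finType) (e : rel T) (he : simple_graph e)
    (r : nat) (V : 'I_r -> {set T}) (hV : multipartite e V)
    (hcard : forall i : 'I_r, #|V i| = 3 * s ^ 2 * Delta)
    (hdeg : max_degree e <= Delta) :
  exists F : {set {set T}}, blowup_factor e V s F.
Proof.
have [es ei] := he; have [Vdisj Vcov Vind] := hV.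
have [p pV] : exists p, forall v, v \in V (p v).
  apply: (@fin_all_exists _ (fun=> 'I_r) (fun v i => v \in V i)) => v.
  have : v \in \bigcup_(i < r) V i by rewrite Vcov inE.
  by case/bigcupP => i _ vi; exists i.
have inV v i : (v \in V i) = (p v == i).
  apply/idP/eqP => [vi|<- //]; apply/eqP/negPn/negP => /Vdisj/pred0P/(_ v).
  by rewrite /= pV vi.
(* [C] indexes the groups of a block and ['I_s] the vertices of a group; [h] turns these coordinates
   into vertices. *)
pose C : finType := 'I_(3 * (s * Delta)).
have [h [g hK gK] hp] : exists2 h : 'I_r * (C * 'I_s) -> T,
    bijective h & forall x, p (h x) = x.1.
  apply: fiber_bijection => i; rewrite card_prod !card_ord.
  have <- : V i = [set v | p v == i] by apply/setP=> v; rewrite inE inV.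
  by rewrite hcard; lia.
have gp v : (g v).1 = p v by rewrite -hp gK.
pose group v : 'I_r * C := ((g v).1, (g v).2.1).
have groupK v : h ((group v).1, ((group v).2, (g v).2.2)) = v.
  by rewrite /group /=; case: (g v) (gK v) => i [j a].
pose eG x y := [exists a, exists b, e (h (x.1, (x.2, a))) (h (y.1, (y.2, b)))].
have eG_group u v : e u v -> eG (group u) (group v).
  move=> euv; apply/existsP; exists (g u).2.2; apply/existsP; exists (g v).2.2.
  by rewrite !groupK.
have eGs : symmetric eG.
  by move=> x y; apply/existsP/existsP => -[a /existsP[b ab]];
    exists b; apply/existsP; exists a; rewrite es.
have eGi : irreflexive eG.
  move=> x; apply/existsP => -[a /existsP[b]]; apply/negP.
  by apply: (Vind x.1); rewrite inV hp.
have deg v : degree e v <= Delta.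
  by apply: leq_trans hdeg; apply: (leq_bigmax_cond v).
have degG x : degree eG x <= s * Delta.
  pose N := \bigcup_(a : 'I_s) [set w | e (h (x.1, (x.2, a))) w].
  have sN : [set y | eG x y] \subset group @: N.
    apply/subsetP=> y; rewrite inE => /existsP[a /existsP[b eab]].
    apply/imsetP; exists (h (y.1, (y.2, b))).
      by apply/bigcupP; exists a; rewrite ?inE.
    by rewrite /group hK; case: (y).
  apply: leq_trans (subset_leq_card sN) _.
  apply: leq_trans (leq_imset_card _ _) _.
  rewrite -[X in X * _]card_ord -sum_nat_const.
  rewrite /N; elim/big_rec2: _ => [|a m B _ leBm]; first by rewrite cards0.
  by apply: leq_trans (leq_card_setU _ _) _; apply: leq_add (deg _) leBm.
have [||c cinj ce] := strong_coloring eGs eGi degG.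
- by rewrite muln_gt0 hs.
- by rewrite card_ord.
pose A k := [set v | c (group v) == k].
exists [set A k | k : C]; split.
- move=> _ /imsetP[k _ ->]; split=> [u v|i].
    rewrite !inE => /eqP cu /eqP cv; apply/negP => /eG_group/ce.
    by rewrite cu cv eqxx.
  (* Exactly one group [j] of block [i] has colour [k], so [A k] meets the block in the [s] vertices
     of that group. *)
  pose j := invF (cinj i) k; pose b (a : 'I_s) := h (i, (j, a)).
  have b_inj : injective b by move=> a a' /(can_inj hK) [].
  rewrite -[RHS]card_ord -cardsT -(card_imset _ b_inj); congr #|pred_of_set _|.
  apply/setP=> v; rewrite !inE inV.
  apply/andP/imsetP => [[/eqP cv /eqP pv]|[a _ ->]].
    exists (g v).2.2; rewrite ?inE // /b -[LHS]groupK /= gp pv.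
    by rewrite /j -cv /group gp pv (invF_f (cinj i)).
  by rewrite /group hK hp /= eqxx (f_invF (cinj i)).
- apply/trivIsetP => _ _ /imsetP[k _ ->] /imsetP[l _ ->] kl.
  apply/pred0P => v /=; rewrite !inE; apply/negP => /andP[/eqP kv /eqP lv].
  by rewrite -kv -lv eqxx in kl.
- apply/setP => v; rewrite inE; apply/bigcupP; exists (A (c (group v))).
    exact: imset_f.
  by rewrite inE.
Qed.
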